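(* Fix an integer $t\geq 1$ and a real $\alpha$ with $\frac{1}{2}<\alpha<1$. Then, as $m\to\infty$ through values for which $\alpha m$ is an integer, \[ t\cdot \sqrt{\frac{1-\alpha}{8(\alpha m)^3}}\cdot 2^{mH_2(\alpha)}\cdot(1+o(1)) \leq R_t(\alpha m,m)\leq t\cdot 4^{H_2(\alpha)}\cdot 2^{mH_2(\alpha)}\cdot (1+o(1)). \]
   Context: $H_2(x)=-x\log_2 x-(1-x)\log_2(1-x)$ is the binary entropy function. For a $t\times n$ matrix $\mathbf{v}$ over $\mathbb{F}_q$ with rows $\overline{v}_1,\dots,\overline{v}_t$, its $t$-weight is $\mathrm{wt}^{(t)}(\mathbf{v})=\left|\bigcup_{i=1}^t \mathrm{supp}(\overline{v}_i)\right|$, and $d^{(t)}(\mathbf{u},\mathbf{v})=\mathrm{wt}^{(t)}(\mathbf{u}-\mathbf{v})$. For a linear code $C\subseteq\mathbb{F}_q^n$ and $t\in\mathbb{N}$, let $C^t$ be the set of $t\times n$ matrices all of whose rows lie in $C$. The $t$-th generalized covering radius $R_t(C)$ is the smallest integer $\rho$ such that for every $\mathbf{v}\in\mathbb{F}_q^{t\times n}$ there is $\mathbf{c}\in C^t$ with $d^{(t)}(\mathbf{v},\mathbf{c})\leq \rho$. Binary Reed–Muller codes $\mathrm{RM}(r,m)\subseteq\mathbb{F}_2^{2^m}$ ($0\le r\le m$) are defined recursively: $\mathrm{RM}(0,m)=\{\overline{0},\overline{1}\}$, $\mathrm{RM}(m,m)=\mathbb{F}_2^{2^m}$, and for $1\leq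 r\leq m-1$, $\mathrm{RM}(r,m)=\{(\overline{u},\overline{u}+\overline{v}) : \overline{u}\in \mathrm{RM}(r,m-1),\ \overline{v}\in\mathrm{RM}(r-1,m-1)\}$. It is a linear code of length $2^m$ and dimension $\sum_{i=0}^r\binom{m}{i}$. Write $R_t(r,m)=R_t(\mathrm{RM}(r,m))$. *)

(* Defs.v *)
From HB Require Import structures.
From mathcomp Require Import all_boot all_order all_algebra.
From mathcomp Require Import reals exp.
Set Implicit Arguments. Unset Strict Implicit. Unset Printing Implicit Defensive.
Import Order.TTheory GRing.Theory Num.Theory.

(* Membership in the binary Reed--Muller code RM(r,m), following the recursive
   definition: RM(0,m) = {0,1}; RM(m,m) = F_2^{2^m};
   RM(r,m) = {(u, u+v) : u in RM(r,m-1), v in RM(r-1,m-1)} for 1 <= r <= m-1.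
   A word w = (u, u') is in the (u,u+v) code iff u in RM(r,m-1) and
   u + u' in RM(r-1,m-1). *)
Fixpoint rm_mem (r m : nat) (w : seq bool) : bool :=
  match m with
  | 0 => size w == 1
  | m'.+1 =>
      if r == 0 then (w == nseq (2 ^ m) false) || (w == nseq (2 ^ m) true)
      else if m <= r then size w == 2 ^ m
      else
        let u := take (2 ^ m') w in
        let u' := drop (2 ^ m') w in
        [&& size w == 2 ^ m, rm_mem r m' u
          & rm_mem r.-1 m' (map (fun p => p.1 (+) p.2) (zip u u'))]
  end.

Definition RM (r m : nat) : pred ((2 ^ m).-tuple bool) := fun w => rm_mem r m w.

Definition mat (t n : nat) := {ffun 'I_t -> n.-tuple bool}.

Definition tdist (t n : nat) (u v : mat t n) : nat :=
  #|[set j : 'I_n | [exists i : 'I_t, tnth (u i) j != tnth (v i) j]]|.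

Definition in_Ct (t n : nat) (C : pred (n.-tuple bool)) (c : mat t n) : bool :=
  [forall i : 'I_t, C (c i)].

Definition covers (t n : nat) (C : pred (n.-tuple bool)) (rho : nat) : bool :=
  [forall v : mat t n, exists c : mat t n, in_Ct C c && (tdist v c <= rho)].

(* R_t(C): the smallest rho with [covers t C rho].  Since tdist <= n, the
   smallest such rho (when any exists) is <= n, so minimizing over rho <= n is
   the literal definition (the default n.+1 is only reached for C empty). *)
Definition gen_cov_radius (t n : nat) (C : pred (n.-tuple bool)) : nat :=
  \big[minn/n.+1]_(rho < n.+1 | covers t C rho) (rho : nat).

Definition Rt (t r m : nat) : nat := @gen_cov_radius t (2 ^ m) (@RM r m).

Local Open Scope ring_scope.

Definition log2 {R : realType} (x : R) : R := ln x / ln 2.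

Definition H2 {R : realType} (x : R) : R := - x * log2 x - (1 - x) * log2 (1 - x).

(* Main.v *)
(* Put n = 2^m and let rho = \sum_(i < m - r) 'C(m, i) be the redundancy of RM(r, m).
   Upper bound: covering the two halves of a word in turn, the (u, u+v)
   construction and Pascal's rule give the covering radius of RM(r, m) at most
   rho, and the rows of a matrix can be covered one by one; moreover
   rho <= 2^(m H2(alpha)) because (alpha + (1 - alpha))^m = 1.
   Lower bound: a ball of radius R in the t x n matrices has at most (n 2^t)^R
   elements, so sphere covering yields t rho <= R (m + t) for R = R_t(r, m).
   Finally rho is at least its last term 'C(m, r+1) = 'C(m, r) (m-r)/(r+1), and
   'C(m, r) >= sqrt(m / (8 r (m-r))) 2^(m H2(r/m)). *)
Require Import Defs.
From HB Require Import structures.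
From mathcomp Require Import all_boot all_order all_algebra.
From mathcomp Require Import reals sequences exp.
From mathcomp Require Import zify ring lra.
Import Order.TTheory GRing.Theory Num.Theory.
Local Open Scope ring_scope.

(** * Redundancy of Reed-Muller codes and Pascal's rule *)

(** For [r <= m], symmetry of the binomial coefficients makes this [2 ^ m] minus the dimension of
    RM(r, m). *)
Definition rm_redundancy (r m : nat) : nat := (\sum_(i < m - r) 'C(m, i))%N.

Lemma sum_binS (m k : nat) :
  (\sum_(i < k.+1) 'C(m.+1, i) = \sum_(i < k) 'C(m, i) + \sum_(i < k.+1) 'C(m, i))%N.
Proof.
rewrite big_ord_recl [in RHS]big_ord_recl !bin0 addnCA; congr (_ + _)%N.
by rewrite -big_split; apply: eq_bigr => i _; rewrite binS addnC.
Qed.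

(** Pascal's rule mirrors the (u, u+v) recursion: the redundancies of the codes of u and v add
    up. *)
Lemma rm_redundancyS (r m : nat) : (r < m)%N ->
  rm_redundancy r.+1 m.+1 = (rm_redundancy r.+1 m + rm_redundancy r m)%N.
Proof.
move=> ltrm; rewrite /rm_redundancy subSS.
by rewrite -(subnSK ltrm) sum_binS.
Qed.

Lemma rm_redundancy0S (m : nat) : (rm_redundancy 0 m).+1 = (2 ^ m)%N.
Proof.
rewrite /rm_redundancy subn0 -[2%N]/(1 + 1)%N expnDn big_ord_recr /= binn.
by rewrite !exp1n !muln1 addn1; congr _.+1; apply: eq_bigr => i _; rewrite !exp1n !muln1.
Qed.

Lemma rm_redundancy_ge (r m : nat) : (m <= r)%N -> rm_redundancy r m = 0%N.
Proof. by rewrite /rm_redundancy -subn_eq0 => /eqP ->; rewrite big_ord0. Qed.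

(** * Covering single words and counting codewords *)

Definition seq_dist (s1 s2 : seq bool) : nat :=
  count (fun p => p.1 != p.2) (zip s1 s2).

Definition xorseq (s1 s2 : seq bool) : seq bool :=
  map (fun p => p.1 (+) p.2) (zip s1 s2).

Lemma size_xorseq (s1 s2 : seq bool) :
  size s1 = size s2 -> size (xorseq s1 s2) = size s1.
Proof. by move=> eqs; rewrite size_map size1_zip ?eqs. Qed.

Lemma xorseqK (s1 s2 : seq bool) :
  size s1 = size s2 -> xorseq s1 (xorseq s1 s2) = s2.
Proof. by elim: s1 s2 => [|x s IH] [|y s2] //= [/IH eqs]; rewrite /xorseq /= in eqs *; rewrite eqs addKb. Qed.

(** Translation by [u] is an isometry. *)
Lemma seq_dist_xorseq (u v w : seq bool) :
  size u = size w -> size v = size w ->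
  seq_dist w (xorseq u v) = seq_dist (xorseq u w) v.
Proof.
elim: u v w => [|x u IH] [|y v] [|z w] //= [szu] [szv].
rewrite /seq_dist /= in IH *; rewrite IH //.
by case: x y z => [] [] [].
Qed.

Lemma rm_mem_size (r m : nat) (w : seq bool) : rm_mem r m w -> size w = (2 ^ m)%N.
Proof.
case: m => [/eqP //|m] /=.
case: ifP => _ => [/orP[]/eqP->|]; rewrite ?size_nseq //.
by case: ifP => _ => [/eqP|/and3P[/eqP]].
Qed.

Lemma rm_memS (r m : nat) (u v : seq bool) : (r < m)%N ->
  rm_mem r.+1 m u -> rm_mem r m v -> rm_mem r.+1 m.+1 (u ++ xorseq u v).
Proof.
move=> ltrm memu memv.
have [szu szv] := (rm_mem_size _ _ _ memu, rm_mem_size _ _ _ memv).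
have szuv : size u = size v by rewrite szu szv.
rewrite /= ltnNge -ltnS ltnS ltrm /= size_cat size_xorseq // szu expnS mul2n addnn eqxx /=.
by rewrite -szu take_size_cat // drop_size_cat // memu [map _ _]xorseqK.
Qed.

(** Repeating the first letter of [w] secures one agreement; the resulting bound n - 1 is the
    redundancy of the repetition code. *)
Lemma seq_dist_nseq (n : nat) (w : seq bool) : size w = n -> (0 < n)%N ->
  exists b, (seq_dist w (nseq n b) < n)%N.
Proof.
case: w => [<- //|b w] /= <- _; exists b.
rewrite /seq_dist /= eqxx add0n ltnS.
by rewrite (leq_trans (count_size _ _)) // size_zip geq_minl.
Qed.

Lemma seq_distxx (w : seq bool) : seq_dist w w = 0%N.
Proof. by elim: w => //= b w; rewrite /seq_dist /= eqxx. Qed.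

Lemma seq_dist_cat (w1 w2 c1 c2 : seq bool) : size w1 = size c1 ->
  seq_dist (w1 ++ w2) (c1 ++ c2) = (seq_dist w1 c1 + seq_dist w2 c2)%N.
Proof. by move=> szw; rewrite /seq_dist zip_cat // count_cat. Qed.

Lemma rm_cover (r m : nat) (w : seq bool) : size w = (2 ^ m)%N ->
  exists2 c, rm_mem r m c & (seq_dist w c <= rm_redundancy r m)%N.
Proof.
elim: m r w => [|m IH] r w szw.
  by exists w; rewrite ?seq_distxx //= szw.
have [le_mr|lt_rm] := leqP m.+1 r.
  exists w; last by rewrite seq_distxx.
  by rewrite /= le_mr szw eqxx; case: r le_mr.
case: r lt_rm => [_|r lt_rm].
  have [b ltb] := seq_dist_nseq _ _ szw (expn_gt0 2 m.+1).
  exists (nseq (2 ^ m.+1) b); first by case: b {ltb}; rewrite /= eqxx ?orbT.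
  by rewrite -ltnS rm_redundancy0S.
have szE : (2 ^ m + 2 ^ m = 2 ^ m.+1)%N by rewrite addnn -mul2n expnS.
have sz1 : size (take (2 ^ m) w) = (2 ^ m)%N.
  by rewrite size_takel // szw -szE leq_addr.
have sz2 : size (drop (2 ^ m) w) = (2 ^ m)%N by rewrite size_drop szw -szE addnK.
have [u memu du] := IH r.+1 _ sz1.
have szu := rm_mem_size _ _ _ memu.
(* The right half must be close to u + v, so [v] is taken close to u plus the right half. *)
have [|v memv dv] := IH r (xorseq u (drop (2 ^ m) w)); first by rewrite size_xorseq szu.
have szv := rm_mem_size _ _ _ memv.
exists (u ++ xorseq u v); first exact: rm_memS.
rewrite -{1}(cat_take_drop (2 ^ m) w) seq_dist_cat ?sz1 // rm_redundancyS //.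
by rewrite seq_dist_xorseq ?leq_add // sz2.
Qed.

(** Sphere covering needs the code size only from above, so it suffices to embed the code into the
    product of the two smaller codes. *)
Lemma card_RM (r m : nat) :
  (#|[set w | @RM r m w]| * 2 ^ rm_redundancy r m <= 2 ^ 2 ^ m)%N.
Proof.
elim: m r => [|m IH] r.
  by rewrite rm_redundancy_ge // muln1 (leq_trans (max_card _)) // card_tuple card_bool.
have [le_mr|lt_rm] := leqP m.+1 r.
  by rewrite rm_redundancy_ge // muln1 (leq_trans (max_card _)) // card_tuple card_bool.
case: r lt_rm => [_|r]; last rewrite ltnS => lt_rm.
  have -> : (2 ^ 2 ^ m.+1 = 2 * 2 ^ rm_redundancy 0 m.+1)%N.
    by rewrite -expnS rm_redundancy0S.
  rewrite leq_mul2r; apply/orP; right.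
  apply: (@leq_trans #|[set nseq_tuple (2 ^ m.+1) false; nseq_tuple (2 ^ m.+1) true]|).
    apply/subset_leq_card/subsetP => w; rewrite !inE -!val_eqE /RM /=.
    exact.
  by rewrite cards2; case: eqP.
pose N := (2 ^ m)%N; pose d := nseq_tuple N false.
(* [f] recovers (u, v) from (u, u+v). The default [d] is never taken, since both sequences have
   length [N]. *)
pose f (w : (2 ^ m.+1).-tuple bool) : N.-tuple bool * N.-tuple bool :=
  (insubd d (take N w), insubd d (xorseq (take N w) (drop N w))).
have szE : (N + N = 2 ^ m.+1)%N by rewrite addnn -mul2n expnS.
have sz1 (w : (2 ^ m.+1).-tuple bool) : size (take N w) = N.
  by rewrite size_takel // size_tuple -szE leq_addr.
have sz2 (w : (2 ^ m.+1).-tuple bool) : size (drop N w) = N.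
  by rewrite size_drop size_tuple -szE addnK.
have f1E w : tval (f w).1 = take N w by rewrite [LHS]val_insubd sz1 eqxx.
have f2E w : tval (f w).2 = xorseq (take N w) (drop N w).
  by rewrite [LHS]val_insubd size_xorseq sz1 ?sz2 ?eqxx.
have injf : injective f.
  move=> w w' eqf; apply: val_inj => /=.
  have eq1 : take N w = take N w' by rewrite -!f1E eqf.
  have eq2 : drop N w = drop N w'.
    rewrite -[LHS](xorseqK (take N w)) ?sz1 ?sz2 // -f2E eqf f2E eq1.
    by rewrite xorseqK ?sz1 ?sz2.
  by rewrite -(cat_take_drop N w) eq1 eq2 cat_take_drop.
rewrite -(card_imset _ injf) rm_redundancyS //.
apply: (@leq_trans (#|setX [set w | @RM r.+1 m w] [set w | @RM r m w]| *
                    2 ^ (rm_redundancy r.+1 m + rm_redundancy r m))).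
  rewrite leq_mul2r; apply/orP; right; apply/subset_leq_card/subsetP => p.
  case/imsetP => w; rewrite inE /RM /= ltnNge -ltnS ltnS lt_rm /= => /and3P[_ mem1 mem2] ->.
  by rewrite !inE /RM f1E mem1 f2E mem2.
by rewrite cardsX expnD mulnACA -szE expnD leq_mul.
Qed.

(** * Generalized covering radius and sphere covering *)

Lemma leq_card_bigcup (I T : finType) (P : pred I) (F : I -> {set T}) :
  (#|\bigcup_(i | P i) F i| <= \sum_(i | P i) #|F i|)%N.
Proof.
elim/big_rec2: _ => [|i A k _ leA]; first by rewrite cards0.
by rewrite (leq_trans (leq_card_setU _ _)) // leq_add2l.
Qed.

Lemma tdist_le (t n : nat) (u v : mat t n) : (tdist u v <= n)%N.
Proof. by rewrite -[leqRHS]card_ord max_card. Qed.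

Lemma gen_cov_radius_le (t n : nat) (C : pred (n.-tuple bool)) (rho : nat) :
  covers t C rho -> (gen_cov_radius t C <= rho)%N.
Proof.
(* The defining minimum ranges over radii up to [n]; truncating [rho] at [n] keeps the covering
   because no distance exceeds [n]. *)
move=> cov; have lt_n : (minn rho n < n.+1)%N by rewrite ltnS geq_minr.
apply: (@leq_trans (minn rho n)); last exact: geq_minl.
rewrite /gen_cov_radius -minEnat -leEnat; apply: (@bigmin_inf _ _ _ _ (Ordinal lt_n)) => //=.
apply/forallP => v; have /existsP[c /andP[memc dc]] := forallP cov v.
by apply/existsP; exists c; rewrite memc leq_min dc tdist_le.
Qed.

(** A finite minimum is either its default or one of the values it ranges over. *)
Lemma gen_cov_radius_ind (t n : nat) (C : pred (n.-tuple bool)) (P : nat -> Prop) :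
  P n.+1 -> (forall rho, covers t C rho -> P rho) -> P (gen_cov_radius t C).
Proof.
move=> Pn Pcov; apply: big_ind => //; last by move=> i; exact: Pcov.
by move=> x y Px Py; rewrite /minn; case: ifP.
Qed.

Lemma seq_distE (n : nat) (u v : n.-tuple bool) :
  seq_dist u v = #|[set j | tnth u j != tnth v j]|.
Proof.
have -> : seq_dist u v = count (fun j => tnth u j != tnth v j) (enum 'I_n).
  rewrite /seq_dist; have -> : zip u v = [seq (tnth u j, tnth v j) | j <- enum 'I_n].
    by rewrite -[in LHS](map_tnth_enum u) -[in LHS](map_tnth_enum v) zip_map.
  by rewrite count_map.
by rewrite cardsE cardE size_filter enumT.
Qed.

Lemma tdist_le_sum (t n : nat) (u v : mat t n) :
  (tdist u v <= \sum_(i < t) seq_dist (u i) (v i))%N.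
Proof.
apply: (@leq_trans (\sum_(i < t) #|[set j | tnth (u i) j != tnth (v i) j]|)); last first.
  by apply: leq_sum => i _; rewrite seq_distE.
apply: leq_trans (leq_card_bigcup _ _ _ _).
apply/subset_leq_card/subsetP => j; rewrite inE => /existsP[i neq].
by apply/bigcupP; exists i; rewrite ?inE.
Qed.

Definition upd_col (t n : nat) (u : mat t n) (j : 'I_n) (x : {ffun 'I_t -> bool}) : mat t n :=
  [ffun i => [tuple if k == j then x i else tnth (u i) k | k < n]].

(* A matrix at distance rho + 1 from c becomes one at distance rho by resetting a
   single column, so each unit of radius costs a factor n 2^t. *)
Lemma card_ball (t n : nat) (c : mat t n) (rho : nat) : (0 < n)%N ->
  (#|[set v | (tdist v c <= rho)%N]| <= (n * 2 ^ t) ^ rho)%N.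
Proof.
move=> n_gt0; elim: rho => [|rho IH].
  rewrite expn0 -(cards1 c); apply/subset_leq_card/subsetP => v.
  rewrite !inE leqn0 cards_eq0 => /eqP/setP eq0.
  apply/eqP/ffunP => i; apply: eq_from_tnth => j.
  have := eq0 j; rewrite !inE => /negbT; rewrite negb_exists => /forallP /(_ i).
  by rewrite negbK => /eqP.
pose B := [set v : mat t n | (tdist v c <= rho)%N].
pose f (p : mat t n * ('I_n * {ffun 'I_t -> bool})) := upd_col t n p.1 p.2.1 p.2.2.
apply: (@leq_trans #|f @: setX B setT|); last first.
  rewrite (leq_trans (leq_imset_card _ _)) // cardsX expnS mulnC leq_mul //.
  by rewrite cardsT card_prod card_ffun card_bool !card_ord.
apply/subset_leq_card/subsetP => v; rewrite inE => dv.
pose col (w : mat t n) (j : 'I_n) : {ffun 'I_t -> bool} := [ffun i => tnth (w i) j].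
have [j dj] : exists j, (tdist (upd_col t n v j (col c j)) c <= rho)%N.
  (* If [v] agrees with [c], resetting any column changes nothing; otherwise a column where they
     differ is reset. *)
  have [D0|[j Dj]] := set_0Vmem [set j : 'I_n | [exists i, tnth (v i) j != tnth (c i) j]].
    exists (Ordinal n_gt0); apply: (@leq_trans 0) => //.
    rewrite leqn0 cards_eq0 -subset0 -D0.
    apply/subsetP => k; rewrite !inE => /existsP[i]; rewrite !ffunE tnth_mktuple.
    by case: (k =P Ordinal n_gt0) => [->|_ neq]; [rewrite eqxx | apply/existsP; exists i].
  exists j; rewrite -ltnS (leq_trans _ dv) // proper_card //.
  apply/properP; split; last first.
    exists j => //; rewrite !inE negb_exists; apply/forallP => i.
    by rewrite !ffunE tnth_mktuple !eqxx.
  apply/subsetP => k; rewrite !inE => /existsP[i]; rewrite !ffunE tnth_mktuple.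
  by case: (k =P j) => [->|_ neq]; [rewrite eqxx | apply/existsP; exists i].
(* Writing the original column [j] back recovers [v]. *)
apply/imsetP; exists (upd_col t n v j (col c j), (j, col v j)); first by rewrite in_setX in_setT andbT inE.
apply/ffunP => i; apply: eq_from_tnth => k; rewrite !ffunE !tnth_mktuple /=.
by case: (k =P j) => [->|_]; rewrite ?tnth_mktuple.
Qed.

(** The balls of radius [rho] around the matrices with all rows in [C] cover the whole space. *)
Lemma sphere_covering (t n : nat) (C : pred (n.-tuple bool)) (rho : nat) : (0 < n)%N ->
  covers t C rho -> (2 ^ (t * n) <= #|[set w | C w]| ^ t * (n * 2 ^ t) ^ rho)%N.
Proof.
move=> n_gt0 /forallP cov.
have cardC : #|[set c : mat t n | in_Ct C c]| = (#|[set w | C w]| ^ t)%N.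
  rewrite -[X in (_ ^ X)%N]card_ord -card_ffun_on; apply: eq_card => c.
  rewrite !inE; apply/forallP/ffun_onP => memC i; have := memC i; rewrite inE //.
have -> : (2 ^ (t * n) = #|mat t n|)%N.
  by rewrite card_ffun card_tuple card_bool card_ord -expnM mulnC.
rewrite -cardC -cardsT.
apply: (@leq_trans (\sum_(c in [set c : mat t n | in_Ct C c])
                      #|[set v | (tdist v c <= rho)%N]|)).
  apply: leq_trans (leq_card_bigcup _ _ _ _).
  apply/subset_leq_card/subsetP => v _.
  have /existsP[c /andP[memc dc]] := cov v.
  by apply/bigcupP; exists c; rewrite inE.
rewrite -sum_nat_const; apply: leq_sum => c _; exact: card_ball.
Qed.

(** * Bounds on the covering radius in terms of the redundancy *)

Lemma Rt_lower (t r m : nat) : (t * rm_redundancy r m <= Rt t r m * (m + t))%N.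
Proof.
apply: (gen_cov_radius_ind t (2 ^ m) (@RM r m) (fun rho => (t * rm_redundancy r m <= rho * (m + t))%N)).
  (* The default [(2 ^ m).+1] satisfies the bound too: the code is nonempty, so [card_RM] gives a
     redundancy of at most [2 ^ m]. *)
  have le_red : (rm_redundancy r m <= 2 ^ m)%N.
    rewrite -(leq_exp2l _ _ (isT : 1 < 2)%N) -[leqLHS]mul1n.
    apply: leq_trans (card_RM r m); rewrite leq_mul2r; apply/orP; right.
    have [c memc _] := rm_cover r m (nseq (2 ^ m) false) (size_nseq _ _).
    have szc : size c == (2 ^ m)%N by rewrite (rm_mem_size _ _ _ memc).
    by apply/card_gt0P; exists (Tuple szc); rewrite inE.
  by rewrite mulnC leq_mul ?leq_addl // (leq_trans le_red).
move=> rho /(sphere_covering _ _ _ _ (expn_gt0 2 m)) le_cov.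
(* With this extra factor, the [t]-th power of [card_RM] eliminates the code size; comparing
   exponents then finishes. *)
have : (2 ^ (t * 2 ^ m) * 2 ^ (t * rm_redundancy r m) <=
        2 ^ (t * 2 ^ m) * 2 ^ (rho * (m + t)))%N.
  apply: leq_trans (leq_mul le_cov (leqnn _)) _; rewrite mulnAC leq_mul //.
    rewrite ![(t * _)%N]mulnC !expnM -expnMn.
    by case: (t) => // t'; rewrite leq_exp2r // card_RM.
  by rewrite -expnD -expnM mulnC.
by rewrite leq_pmul2l ?expn_gt0 // leq_exp2l.
Qed.

(** Rows are covered independently; the support of a matrix is the union of the supports of its
    rows. *)
Lemma Rt_upper (t r m : nat) : (Rt t r m <= t * rm_redundancy r m)%N.
Proof.
apply: gen_cov_radius_le; apply/forallP => v.
have ex i : exists c : (2 ^ m).-tuple bool,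
    @RM r m c && (seq_dist (v i) c <= rm_redundancy r m)%N.
  have [c memc dc] := rm_cover r m (v i) (size_tuple _).
  have szc : size c == (2 ^ m)%N by rewrite (rm_mem_size _ _ _ memc).
  by exists (Tuple szc); rewrite /RM memc dc.
pose c : mat t (2 ^ m) := [ffun i => xchoose (ex i)].
have memc i : @RM r m (c i) by rewrite ffunE; have /andP[] := xchooseP (ex i).
have dc i : (seq_dist (v i) (c i) <= rm_redundancy r m)%N.
  by rewrite ffunE; have /andP[] := xchooseP (ex i).
apply/existsP; exists c; apply/andP; split; first by apply/forallP.
apply: leq_trans (tdist_le_sum _ _ _ _) _.
by rewrite (leq_trans (leq_sum _ (fun i _ => dc i))) // sum_nat_const card_ord.
Qed.

(** * Lower bound for a binomial coefficient *)

(** In the induction, multiplying by [1 + x] leaves an excess of n(n-1)(n-2)/6 x^4, which is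
    nonnegative. *)
Lemma cubic_bernoulli (F : realFieldType) (x : F) (n : nat) : 0 <= x ->
  1 + n%:R * x + n%:R * (n%:R - 1) / 2 * x ^+ 2
    + n%:R * (n%:R - 1) * (n%:R - 2) / 6 * x ^+ 3 <= (1 + x) ^+ n.
Proof.
move=> x_ge0; elim: n => [|n IH]; first by rewrite !mul0r !addr0.
have n3_ge0 : 0 <= n%:R * (n%:R - 1) * (n%:R - 2) :> F.
  case: n {IH} => [|[|n]]; [by rewrite !mul0r | by rewrite subrr mulr0 mul0r |].
  by rewrite !mulr_ge0 ?subr_ge0 ?ler1n ?ler_nat.
rewrite [leRHS]exprS; apply: le_trans (ler_wpM2l (addr_ge0 ler01 x_ge0) IH).
rewrite -subr_ge0 -natr1.
rewrite [leRHS](_ : _ = n%:R * (n%:R - 1) * (n%:R - 2) / 6 * x ^+ 4); last by field.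
by rewrite mulr_ge0 ?exprn_ge0 // divr_ge0.
Qed.

(* The quadratic Bernoulli inequality is too weak here: the cubic term is needed. *)
Lemma ratio_exp_decr (F : realFieldType) (k : nat) : (0 < k)%N ->
  (k.+2%:R / k.+1%:R) ^+ k.*2.+3 <= (k.+1%:R / k%:R) ^+ k.*2.+1 :> F.
Proof.
move=> k_gt0; have x_ge1 : 1 <= k%:R :> F by rewrite ler1n.
set n := k.*2.+1; have nE : n%:R = 2 * k%:R + 1 :> F.
  by rewrite /n -addn1 natrD -mul2n natrM.
have -> : k.*2.+3 = (n + 2)%N by rewrite addn2.
clearbody n; rewrite -!natr1.
move: (k%:R) x_ge1 nE => x x_ge1 nE.
have x_gt0 : 0 < x by lra.
(* [1 + y] is the quotient of the two bases, so the claim becomes ((x+2)/(x+1))^2 <= (1+y)^n. *)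
pose y := (x * (x + 2))^-1.
have y_ge0 : 0 <= y by rewrite invr_ge0 mulr_ge0; lra.
have -> : (x + 1) / x = (x + 1 + 1) / (x + 1) * (1 + y) by rewrite /y; field; lra.
rewrite exprD [leRHS]exprMn ler_wpM2l ?exprn_ge0 ?divr_ge0; try lra.
apply: le_trans (cubic_bernoulli F y n y_ge0); rewrite nE -subr_ge0.
(* The only negative coefficient of the numerator is absorbed in [16 * x - 1], positive as
   [1 <= x]. *)
have -> : 1 + (2 * x + 1) * y + (2 * x + 1) * (2 * x + 1 - 1) / 2 * y ^+ 2 +
    (2 * x + 1) * (2 * x + 1 - 1) * (2 * x + 1 - 2) / 6 * y ^+ 3 -
    ((x + 1 + 1) / (x + 1)) ^+ 2 =
    (x ^+ 4 + 5 * x ^+ 3 + 18 * x ^+ 2 + (16 * x - 1)) /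
    (3 * x ^+ 2 * (x + 2) ^+ 3 * (x + 1) ^+ 2) by rewrite /y; field; lra.
have x2_ge0 : 0 <= x + 2 by lra.
have x1_ge0 : 0 <= x + 1 by lra.
have l_ge0 : 0 <= 16 * x - 1 by lra.
have x_ge0 := ltW x_gt0.
apply: divr_ge0; last by rewrite !mulr_ge0 ?exprn_ge0.
by apply: addr_ge0 => //; rewrite !addr_ge0 ?mulr_ge0 ?exprn_ge0.
Qed.

Lemma ratio_exp_decr_le (F : realFieldType) (k l : nat) : (0 < k)%N ->
  ((k + l).+1%:R / (k + l)%:R) ^+ (k + l).*2.+1 <= (k.+1%:R / k%:R) ^+ k.*2.+1 :> F.
Proof.
move=> k_gt0; elim: l => [|l IH]; first by rewrite addn0.
by apply: le_trans IH; rewrite addnS doubleS ratio_exp_decr // ltn_addr.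
Qed.

(* The square of 'C(n, k) 2^(- n H2(k/n)) sqrt(k l / n), with n = k + l. It increases
   in k and in l, hence is smallest at k = l = 1, where it equals 1/8. *)
Definition bin_entropy_ratio (F : realFieldType) (k l : nat) : F :=
  'C(k + l, k)%:R ^+ 2 * k%:R ^+ k.*2.+1 * l%:R ^+ l.*2.+1 / (k + l)%:R ^+ (k + l).*2.+1.

Lemma bin_entropy_ratioC (F : realFieldType) (k l : nat) :
  bin_entropy_ratio F k l = bin_entropy_ratio F l k.
Proof.
rewrite /bin_entropy_ratio [in RHS]addnC; congr (_ / _).
by rewrite -(bin_sub (leq_addr l k)) addKn mulrAC.
Qed.

(** With n = k + l, the quotient of the two ratios is ((k+1)/k)^(2k+1) divided by
    ((n+1)/n)^(2n+1). *)
Lemma bin_entropy_ratio_incr (F : realFieldType) (k l : nat) : (0 < k)%N ->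
  bin_entropy_ratio F k l <= bin_entropy_ratio F k.+1 l.
Proof.
move=> k_gt0; have := ratio_exp_decr_le F k l k_gt0.
have binE : k.+1%:R * 'C((k + l).+1, k.+1)%:R = (k + l).+1%:R * 'C(k + l, k)%:R :> F.
  by rewrite -!natrM -mul_bin_diag.
rewrite /bin_entropy_ratio addSn !doubleS.
have k0 : 0 < k%:R :> F by rewrite ltr0n.
have k1 : 0 < k.+1%:R :> F by rewrite ltr0n.
have n0 : 0 < (k + l)%:R :> F by rewrite ltr0n ltn_addr.
have n1 : 0 < (k + l).+1%:R :> F by rewrite ltr0n.
have -> : 'C((k + l).+1, k.+1)%:R = (k + l).+1%:R * 'C(k + l, k)%:R / k.+1%:R :> F.
  by rewrite -binE mulrC mulKf // gt_eqF.
rewrite !expr_div_n => le_s.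
set B := 'C(k + l, k)%:R; set L := l%:R ^+ _.
have L_ge0 : 0 <= L by rewrite exprn_ge0.
rewrite -[k.*2.+3]addn2 -[(k + l).*2.+3]addn2 !exprD.
move: le_s L_ge0.
have := exprn_gt0 k.*2.+1 k0; have := exprn_gt0 k.*2.+1 k1.
have := exprn_gt0 (k + l).*2.+1 n0; have := exprn_gt0 (k + l).*2.+1 n1.
set a := _ ^+ _; set b := _ ^+ _; set c := _ ^+ _; set d := _ ^+ _.
clearbody a b c d L B => a0 b0 c0 d0 le_s L0.
move: k1 n1 {binE k0 n0}; move: (k.+1%:R : F) ((k + l).+1%:R : F) => x y x0 y0.
have -> : (y * B) ^+ 2 / x ^+ 2 * (c * x ^+ 2) * L / (a * y ^+ 2) = B ^+ 2 * d * L / a * (c / d).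
  by field; rewrite !gt_eqF.
have -> : B ^+ 2 * d * L / b = B ^+ 2 * d * L / a * (a / b) by field; rewrite !gt_eqF.
rewrite ler_wpM2l // divr_ge0 ?(ltW a0) // mulr_ge0 // mulr_ge0 ?sqr_ge0 //; exact: ltW.
Qed.

Lemma bin_entropy_ratio_ge (F : realFieldType) (k l : nat) : (0 < k)%N -> (0 < l)%N ->
  1 / 8 <= bin_entropy_ratio F k l.
Proof.
case: k l => // k [] // l _ _.
have ge1 n j : (bin_entropy_ratio F 1 n <= bin_entropy_ratio F j.+1 n).
  elim: j => // j /le_trans; apply; exact: bin_entropy_ratio_incr.
apply: le_trans (ge1 _ _); rewrite bin_entropy_ratioC; apply: le_trans (ge1 _ _).
by rewrite /bin_entropy_ratio /= bin1 !expr1n !mulr1 -[X in _ <= X](_ : 1 / 8 = _) //; field.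
Qed.

(** * Binomial sums and entropy *)

(** In the expansion of (p + (1-p))^m = 1 keep the terms with i < k; as p >= 1-p, each weight is at
    least the one at i = k. *)
Lemma sum_bin_le (F : realFieldType) (p : F) (k m : nat) : (k <= m)%N ->
  1 / 2 <= p -> p <= 1 ->
  (\sum_(i < k) 'C(m, i))%N%:R * (p ^+ (m - k) * (1 - p) ^+ k) <= 1.
Proof.
move=> le_km p_ge p_le.
have [p_ge0 q_ge0] : 0 <= p /\ 0 <= 1 - p by lra.
rewrite [leRHS](_ : 1 = \sum_(i < m.+1) p ^+ (m - i) * (1 - p) ^+ i *+ 'C(m, i)); last first.
  by rewrite -exprDn subrKC expr1n.
rewrite natr_sum mulr_suml.
rewrite -(big_mkord xpredT (fun i => 'C(m, i)%:R * (p ^+ (m - k) * (1 - p) ^+ k))).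
rewrite -(big_mkord xpredT (fun i => p ^+ (m - i) * (1 - p) ^+ i *+ 'C(m, i))).
rewrite [leRHS](@big_cat_nat _ _ _ k) //=; last exact: leqW.
rewrite -[leLHS]addr0 lerD //; last first.
  by apply: sumr_ge0 => i _; rewrite mulrn_wge0 // mulr_ge0 ?exprn_ge0.
rewrite !big_nat ler_sum // => i /andP[_ lt_ik].
rewrite mulr_natl lerMn2r; apply/orP; right.
rewrite -(subnKC (ltnW lt_ik)) exprD mulrA [leLHS]mulrAC ler_wpM2r ?exprn_ge0 //.
have -> : (m - i = m - (i + (k - i)) + (k - i))%N by lia.
rewrite exprD ler_wpM2l ?exprn_ge0 // lerXn2r ?nnegrE //; lra.
Qed.

(** The second factor is the probability of one word with r ones and k zeros under bias alpha; it
    links entropy to the weights of [sum_bin_le]. *)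
Lemma powR_H2 (R : realType) (alpha : R) (r k : nat) :
  0 < alpha -> alpha < 1 -> r%:R = alpha * (r + k)%:R ->
  2 `^ ((r + k)%:R * H2 alpha) * (alpha ^+ r * (1 - alpha) ^+ k) = 1.
Proof.
move=> a_gt0 a_lt1 rE.
have kE : k%:R = (1 - alpha) * (r + k)%:R by move: rE; rewrite natrD; lra.
have ln2 : ln (2 : R) != 0 by rewrite gt_eqF // ln_gt0 // ltr1n.
have -> : 2 `^ ((r + k)%:R * H2 alpha) =
          expR (- (r%:R * ln alpha) - k%:R * ln (1 - alpha)).
  rewrite /powR pnatr_eq0 /= rE kE /H2 /log2; congr expR; by field.
have powE (x : R) n : 0 < x -> x ^+ n = expR (n%:R * ln x).
  by move=> x0; rewrite expRM_natl lnK.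
by rewrite !powE ?subr_gt0 // -!expRD addrACA addNr addNr addr0 expR0.
Qed.

Lemma H2_ge0 (R : realType) (alpha : R) : 0 < alpha -> alpha < 1 -> 0 <= H2 alpha.
Proof.
move=> a_gt0 a_lt1; have ln2 : 0 < ln (2 : R) by rewrite ln_gt0 // ltr1n.
have log_le0 (x : R) : x <= 1 -> log2 x <= 0.
  by move=> x_le1; rewrite /log2 pmulr_lle0 ?invr_gt0 // ln_le0.
have := mulr_ge0_le0 (ltW a_gt0) (log_le0 _ (ltW a_lt1)).
have b_ge0 : 0 <= 1 - alpha by lra.
have /(log_le0 _)/(mulr_ge0_le0 b_ge0) : 1 - alpha <= 1 by lra.
rewrite /H2; lra.
Qed.

Lemma bin_le_rm_redundancy (r m : nat) : (r < m)%N ->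
  ((m - r) * 'C(m, r) <= rm_redundancy r m * r.+1)%N.
Proof.
move=> lt_rm; rewrite -mul_bin_left mulnC leq_mul2r; apply/orP; right.
by rewrite /rm_redundancy -(subnSK lt_rm) big_ord_recr /= bin_sub // leq_addl.
Qed.

(** With m = r + k, the factor (1-alpha)/(alpha m) is the leading form of (m-r)/((r+1)(m+t)), the
    loss from ['C(m, r)] to the radius per row. *)
Lemma bin_entropy_ge (R : realType) (alpha : R) (r k : nat) :
  0 < alpha -> alpha < 1 -> (0 < r)%N -> (0 < k)%N -> r%:R = alpha * (r + k)%:R ->
  Num.sqrt ((1 - alpha) / (8 * (alpha * (r + k)%:R) ^+ 3)) *
    2 `^ ((r + k)%:R * H2 alpha) * (alpha * (r + k)%:R)
  <= (1 - alpha) * 'C(r + k, r)%:R.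
Proof.
move=> a_gt0 a_lt1 r_gt0 k_gt0 rE.
have kE : k%:R = (1 - alpha) * (r + k)%:R by move: rE; rewrite natrD; lra.
have XE := powR_H2 _ _ _ _ a_gt0 a_lt1 rE.
have M_gt0 : 0 < (r + k)%:R :> R by rewrite ltr0n ltn_addr.
set X := 2 `^ _ in XE *; set B := 'C(_, _)%:R; set M := (r + k)%:R in M_gt0 *.
have b_gt0 : 0 < 1 - alpha by lra.
(* All powers of [M] cancel except one, and [XE] turns the last square into X^(-2). *)
have ratioE : bin_entropy_ratio R r k =
    alpha * (1 - alpha) * M * B ^+ 2 * (alpha ^+ r * (1 - alpha) ^+ k) ^+ 2.
  rewrite /bin_entropy_ratio rE kE -/B -/M doubleD -addSn exprD.
  rewrite !exprMn !exprSr -!mul2n !exprM ![_ ^+ 2 ^+ _]exprAC.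
  have := exprn_gt0 k M_gt0; have := exprn_gt0 r M_gt0; clearbody M B.
  move: (M ^+ r) (M ^+ k) => u v u_gt0 v_gt0.
  by field; rewrite !gt_eqF.
have B_ge0 : 0 <= B by [].
have le_B : X ^+ 2 <= 8 * alpha * (1 - alpha) * M * B ^+ 2.
  have := bin_entropy_ratio_ge R r k r_gt0 k_gt0.
  by rewrite ratioE => /(ler_wpM2l (sqr_ge0 X)); rewrite [X in _ <= X -> _]mulrCA -exprMn XE; lra.
clearbody M B.
rewrite -ler_sqr ?nnegrE; last first.
- by rewrite mulr_ge0 // ltW.
- by rewrite !mulr_ge0 ?sqrtr_ge0 ?powR_ge0 // ltW.
rewrite !exprMn sqr_sqrtr; last first.
  by rewrite divr_ge0 ?(ltW b_gt0) // !mulr_ge0 ?exprn_ge0 ?(ltW a_gt0) ?(ltW M_gt0).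
rewrite [leLHS](_ : _ = (1 - alpha) / (8 * alpha * M) * X ^+ 2); last first.
  by field; rewrite !gt_eqF.
rewrite [leRHS](_ : _ = (1 - alpha) / (8 * alpha * M) *
  (8 * alpha * (1 - alpha) * M * B ^+ 2)); last by field; rewrite !gt_eqF.
by rewrite ler_wpM2l // divr_ge0 ?ltW // !mulr_gt0.
Qed.

(** * Passage to the asymptotic bounds *)

Theorem theorem16 (R : realType) (t : nat) (alpha : R) :
  (1 <= t)%N -> 1 / 2 < alpha -> alpha < 1 ->
  forall eps : R, 0 < eps ->
  exists M : nat, forall m r : nat, (M <= m)%N -> r%:R = alpha * m%:R ->
    (1 - eps) * (t%:R * Num.sqrt ((1 - alpha) / (8 * (alpha * m%:R) ^+ 3))
                 * 2 `^ (m%:R * H2 alpha))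
      <= (Rt t r m)%:R
    /\ (Rt t r m)%:R
      <= (1 + eps) * (t%:R * 4 `^ (H2 alpha) * 2 `^ (m%:R * H2 alpha)).
Proof.
move=> _ a_gt12 a_lt1 eps eps_gt0.
have a_gt0 : 0 < alpha by lra.
(* The relative loss in replacing (alpha m + 1)(m + t) by alpha m^2 is at most (2 + t)/m, which this
   threshold keeps below eps. *)
exists (Num.Def.archi_bound ((2 + t%:R) / eps)) => m r le_m rE.
have eps_m : 2 + t%:R <= eps * m%:R.
  rewrite mulrC -ler_pdivrMr //; apply: le_trans (ltW (archi_boundP _)) _.
    by rewrite divr_ge0 ?addr_ge0 // ltW.
  by rewrite ler_nat.
have m_gt0 : 0 < m%:R :> R.
  by rewrite -(pmulr_rgt0 _ eps_gt0); apply: lt_le_trans eps_m; rewrite ltr_pwDl.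
have r_gt0 : (0 < r)%N by rewrite -(ltr0n R) rE mulr_gt0.
have lt_rm : (r < m)%N by rewrite -(ltr_nat R) rE gtr_pMl.
have mE : m = (r + (m - r))%N by rewrite subnKC // ltnW.
have k_gt0 : (0 < m - r)%N by rewrite subn_gt0.
have rE' : r%:R = alpha * (r + (m - r))%:R by rewrite -mE.
have XE := powR_H2 _ _ _ _ a_gt0 a_lt1 rE'; rewrite -mE in XE.
set X := 2 `^ _ in XE *.
have X_ge0 : 0 <= X by rewrite powR_ge0.
have t_ge0 : 0 <= t%:R :> R by [].
split.
  have := bin_entropy_ge _ _ _ _ a_gt0 a_lt1 r_gt0 k_gt0 rE'; rewrite -mE -/X.
  set S := Num.sqrt _ => le_bin; have S_ge0 : 0 <= S by exact: sqrtr_ge0.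
  have le_red : (1 - alpha) * m%:R * 'C(m, r)%:R <=
                (rm_redundancy r m)%:R * (alpha * m%:R + 1).
    rewrite -rE natr1 -natrM; apply: le_trans (_ : ((m - r) * 'C(m, r))%:R <= _).
      by rewrite natrM natrB ?(ltnW lt_rm) // rE mulrBl mul1r.
    by rewrite ler_nat bin_le_rm_redundancy.
  have le_Rt : t%:R * (rm_redundancy r m)%:R <= (Rt t r m)%:R * (m%:R + t%:R) :> R.
    by rewrite -natrD -!natrM ler_nat Rt_lower.
  set M : R := m%:R in eps_m m_gt0 le_bin le_red le_Rt *.
  have am1_gt0 : 0 < alpha * M + 1 by rewrite ltr_wpDl // mulr_ge0 // ltW.
  have Mt_gt0 : 0 < M + t%:R by rewrite ltr_wpDr.
  (* This clears two denominators: r + 1 from the last binomial term and m + t from sphere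
     covering. *)
  rewrite -(ler_pM2r (mulr_gt0 am1_gt0 Mt_gt0)).
  have le_eps : (1 - eps) * ((alpha * M + 1) * (M + t%:R)) <= alpha * M ^+ 2.
    rewrite -(ler_pM2r m_gt0).
    apply: (@le_trans _ _ ((M - 2 - t%:R) * ((alpha * M + 1) * (M + t%:R)))).
      by rewrite mulrAC ler_wpM2r ?(ltW (mulr_gt0 am1_gt0 Mt_gt0)) //; lra.
    have aM_ge0 : 0 <= M ^+ 2 * (2 * alpha - 1).
      by rewrite mulr_ge0 ?sqr_ge0 //; lra.
    have tam_ge0 : 0 <= (alpha * M + 1) * (t%:R * (2 + t%:R)).
      by rewrite mulr_ge0 ?(ltW am1_gt0) // mulr_ge0 // addr_ge0.
    rewrite -subr_ge0.
    (* The 2 in the threshold produces the coefficient [2 * alpha - 1], nonnegative since alpha >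
       1/2. *)
    suff -> : alpha * M ^+ 2 * M - (M - 2 - t%:R) * ((alpha * M + 1) * (M + t%:R)) =
       M ^+ 2 * (2 * alpha - 1) + 2 * M + (alpha * M + 1) * (t%:R * (2 + t%:R)).
      by rewrite !addr_ge0 // mulr_ge0 // ltW.
    by ring.
  apply: (@le_trans _ _ (t%:R * S * X * (alpha * M ^+ 2))).
    by rewrite mulrAC mulrC ler_wpM2l ?mulr_ge0.
  apply: (@le_trans _ _ (t%:R * ((1 - alpha) * M * 'C(m, r)%:R))).
    have := ler_wpM2l (mulr_ge0 t_ge0 (ltW m_gt0)) le_bin.
    by congr (_ <= _); ring.
  apply: le_trans (ler_wpM2l t_ge0 le_red) _.
  by rewrite [leLHS]mulrA [leLHS]mulrC [leRHS]mulrCA ler_wpM2l // ltW.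
apply: (@le_trans _ _ (t%:R * X)).
  apply: (@le_trans _ _ (t%:R * (rm_redundancy r m)%:R)).
    by rewrite -natrM ler_nat Rt_upper.
  rewrite ler_wpM2l //.
  (* With p = alpha and k = m - r the weight is alpha^r (1-alpha)^(m-r), the inverse of [X]. *)
  have := sum_bin_le R alpha (m - r) m (leq_subr r m) (ltW a_gt12) (ltW a_lt1).
  rewrite (subKn (ltnW lt_rm)) -/(rm_redundancy r m) => /(ler_wpM2l X_ge0).
  by rewrite mulrCA XE !mulr1.
have four_ge1 : 1 <= 4 `^ (H2 alpha) :> R.
  have four_ge1 : 1 <= 4 :> R by rewrite ler1n.
  by have := ler_powR four_ge1 (H2_ge0 R alpha a_gt0 a_lt1); rewrite powRr0.
rewrite -[leLHS]mul1r ler_pM ?mulr_ge0 //; first by rewrite lerDl ltW.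
by rewrite ler_wpM2r // ler_peMr.
Qed.
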